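(* Let $F$ be a non-abelian free group of finite rank, let $\iota_1,\iota_2:F\to F*F$ be the canonical inclusions of the two factors, and let $\iota:F\to F*F$ be the map $\iota(g)=\iota_1(g)\iota_2(g)$. Then $\iota$ is a quasihomomorphism.
   Context: A quasimorphism of a group $G$ is a map $\varphi:G\to\mathbb{R}$ with $\sup_{g,h\in G}|\varphi(g)+\varphi(h)-\varphi(gh)|<\infty$; $Q(G)$ denotes the space of quasimorphisms. A map $f:G\to H$ between groups is a quasihomomorphism if $\varphi\circ f\in Q(G)$ for every $\varphi\in Q(H)$. *)

(* Defs.v *)
From mathcomp Require Import all_boot all_order all_algebra.
From mathcomp Require Import all_classical all_reals ereal.

Set Implicit Arguments.
Unset Strict Implicit.
Unset Printing Implicit Defensive.

Import Order.TTheory GRing.Theory Num.Theory.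

Local Open Scope classical_set_scope.
Local Open Scope ring_scope.

Definition defect {R : realType} {G : groupType} (phi : G -> R) : \bar R :=
  ereal_sup [set (`|phi gh.1 + phi gh.2 - phi (gh.1 * gh.2)%g|)%:E
            | gh in [set: G * G]].

Definition quasimorphism {R : realType} {G : groupType} (phi : G -> R) : Prop :=
  (defect phi < +oo)%E.

Definition quasihomomorphism (R : realType) (G H : groupType) (f : G -> H) :
    Prop :=
  forall phi : H -> R,
    quasimorphism phi -> quasimorphism (phi \o f).

(* Between groups, {multiplicative G -> H} is the type of group homomorphisms:
   preservation of 1 and of inverses is automatic.  Free groups and free
   products are given by their universal properties; uniqueness of the induced
   homomorphism is pointwise. *)
Definition free_basis (I : Type) (F : groupType) (X : I -> F) : Prop :=
  forall (H : groupType) (a : I -> H),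
    (exists f : {multiplicative F -> H}, forall i, f (X i) = a i) /\
    (forall f f' : {multiplicative F -> H},
       (forall i, f (X i) = a i) -> (forall i, f' (X i) = a i) -> f =1 f').

Definition free_of_finite_rank (F : groupType) : Prop :=
  exists (n : nat) (X : 'I_n -> F), free_basis X.

Definition nonabelian (G : groupType) : Prop :=
  exists x y : G, (x * y)%g <> (y * x)%g.

(* P is the free product A * B, with canonical inclusions i1 and i2. *)
Definition free_product (A B P : groupType)
    (i1 : {multiplicative A -> P}) (i2 : {multiplicative B -> P}) : Prop :=
  forall (H : groupType)
    (a : {multiplicative A -> H}) (b : {multiplicative B -> H}),
    (exists f : {multiplicative P -> H}, f \o i1 =1 a /\ f \o i2 =1 b) /\
    (forall f f' : {multiplicative P -> H},
       f \o i1 =1 a -> f \o i2 =1 b ->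
       f' \o i1 =1 a -> f' \o i2 =1 b -> f =1 f').

(* Main.v *)
(* Up to an error at most D(phi), phi (iota1 g * iota2 g) equals
   phi (iota1 g) + phi (iota2 g), a sum of two quasimorphisms of defect at most
   D(phi); hence phi \o iota has defect at most 5 D(phi). *)
Require Import Defs.
From mathcomp Require Import all_boot all_order all_algebra.
From mathcomp Require Import all_classical all_reals ereal.
From mathcomp Require Import lra.

Import Order.TTheory GRing.Theory Num.Theory.

(** Trades the extended-real supremum for a real bound, so that estimates become linear inequalities
    over [R]. *)
Lemma quasimorphismP (R : realType) (G : groupType) (phi : G -> R) :
  quasimorphism phi <->
  exists D : R, forall g h : G,
    (`|phi g + phi h - phi (g * h)%g| <= D)%R.
Proof.
split=> [hphi|[D hD]].
- have le_defect g h :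
      ((`|phi g + phi h - phi (g * h)%g|%R)%:E <= defect phi)%E.
    by apply: ereal_sup_ubound; exists (g, h).
  move: hphi le_defect; rewrite /quasimorphism.
  case: (defect phi) => [D _ leD|//|_ leD].
  + by exists D => g h; rewrite -lee_fin.
  (* The supremum is not [-oo]: the pair of identities contributes a real value. *)
  + by have := leD 1%g 1%g.
- apply: (@le_lt_trans _ _ D%:E); last exact: ltry.
  by apply: ge_ereal_sup => _ [[g h] _ <-]; rewrite lee_fin.
Qed.

Lemma quasihomomorphism_mul (R : realType) (G H : groupType)
    (f1 f2 : {multiplicative G -> H}) :
  quasihomomorphism R (fun g : G => (f1 g * f2 g)%g).
Proof.
move=> phi /quasimorphismP[D hD]; apply/quasimorphismP.
exists (5 * D)%R => g h /=.
(* Two bounds for the defects of [phi \o f1] and [phi \o f2], then three splitting [phi] on the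
   products at [g], [h] and [g * h]. *)
have := hD (f1 g) (f1 h); have := hD (f2 g) (f2 h).
have := hD (f1 g) (f2 g); have := hD (f1 h) (f2 h).
have := hD (f1 (g * h)%g) (f2 (g * h)%g).
(* Multiplicativity makes the terms at [f1 (g * h)] and [f2 (g * h)] cancel. *)
rewrite -!gmulfM !ler_norml; lra.
Qed.

Theorem lemma5p15 (R : realType) (F : groupType)
    (hfree : free_of_finite_rank F) (hnonab : nonabelian F)
    (FF : groupType) (iota1 iota2 : {multiplicative F -> FF})
    (hprod : free_product iota1 iota2) :
  quasihomomorphism R (fun g : F => (iota1 g * iota2 g)%g).
Proof. exact: quasihomomorphism_mul. Qed.
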